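(* We have $Z^\star_{\rm CVaR} = Z^\star_{\rm ICC}(\mathbf{e})$.
   Context: Data: a compact polyhedron $\mathcal{X} \subseteq \mathbb{R}^L$; a cost vector $\boldsymbol{c}\in\mathbb{R}^L$; a matrix $\boldsymbol{A} \in \mathbb{R}^{L\times K}$, vectors $\boldsymbol{a} \in \mathbb{R}^L$, $\boldsymbol{b} \in \mathbb{R}^K$ and a scalar $b_0 \in \mathbb{R}$ such that $\boldsymbol{A}^\top \boldsymbol{x} \neq \boldsymbol{b}$ for all $\boldsymbol{x} \in \mathcal{X}$; samples $\hat{\boldsymbol{\xi}}_1,\dots,\hat{\boldsymbol{\xi}}_N \in \mathbb{R}^K$; a risk threshold $\varepsilon \in (0,1)$; a radius $\theta \ge 0$; a norm $\|\cdot\|$ on $\mathbb{R}^K$ with dual norm $\|\cdot\|_*$. Write $[N]=\{1,\dots,N\}$, $\mathbf{e}$ for the all-ones vector and $(y)^+=\max\{y,0\}$. Wasserstein ball: $\mathcal{F}(\theta) = \{\mathbb{P}\in\mathcal{P}(\mathbb{R}^K) : d_{\rm W}(\mathbb{P},\hat{\mathbb{P}})\le\theta\}$, where $\mathcal{P}(\mathbb{R}^K)$ is the set of probability distributions on $\mathbb{R}^K$, $\hat{\mathbb{P}}=\frac1N\sum_{i=1}^N\delta_{\hat{\boldsymbol{\xi}}_i}$ is the empirical distribution and $d_{\rm W}(\mathbb{P}_1,\mathbb{P}_2)=\inf \mathbb{E}[\|\tilde{\boldsymbol{\xi}}_1-\tilde{\boldsymbol{\xi}}_2\|]$, the infimum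 being over all joint distributions of $(\tilde{\boldsymbol{\xi}}_1,\tilde{\boldsymbol{\xi}}_2)$ with marginals $\mathbb{P}_1,\mathbb{P}_2$. CVaR: $\mathbb{P}\text{-CVaR}_\varepsilon(\ell(\tilde{\boldsymbol{\xi}}))=\inf\{\tau+\mathbb{E}_{\mathbb{P}}[(\ell(\tilde{\boldsymbol{\xi}})-\tau)^+]/\varepsilon : \tau\in\mathbb{R}\}$. Worst-case CVaR constrained program: $$Z^\star_{\rm CVaR}=\min_{\boldsymbol{x}\in\mathcal{X}}\Big\{\boldsymbol{c}^\top\boldsymbol{x} \;:\; \sup_{\mathbb{P}\in\mathcal{F}(\theta)}\mathbb{P}\text{-CVaR}_\varepsilon\big(\boldsymbol{a}^\top\boldsymbol{x}-b_0+(\boldsymbol{A}^\top\boldsymbol{x}-\boldsymbol{b})^\top\tilde{\boldsymbol{\xi}}\big)\le 0\Big\}.$$ For $\boldsymbol{\kappa}\in[0,1]^N$ define $$\mathcal{C}_{\rm ICC}(\boldsymbol{\kappa}) = \left\{(\boldsymbol{x},\boldsymbol{s},t)\in\mathcal{X}\times\mathbb{R}^N_+\times\mathbb{R} \;:\; \varepsilon N t - \mathbf{e}^\top\boldsymbol{s} \ge \theta N \|\boldsymbol{b}-\boldsymbol{A}^\top\boldsymbol{x}\|_*,\; \kappa_i\big((\boldsymbol{b}-\boldsymbol{A}^\top\boldsymbol{x})^\top\hat{\boldsymbol{\xi}}_i + b_0 - \boldsymbol{a}^\top\boldsymbol{x}\big) \ge t - s_i \;\forall i\in[N]\right\}$$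 and $Z^\star_{\rm ICC}(\boldsymbol{\kappa}) = \min\{\boldsymbol{c}^\top\boldsymbol{x} : (\boldsymbol{x},\boldsymbol{s},t)\in\mathcal{C}_{\rm ICC}(\boldsymbol{\kappa})\}$. The optimal value of an infeasible minimization problem is $+\infty$. *)

(* Defs.v *)
From HB Require Import structures.
From mathcomp Require Import all_boot all_order all_algebra.
From mathcomp Require Import all_classical all_reals all_analysis.
Set Implicit Arguments.
Unset Strict Implicit.
Unset Printing Implicit Defensive.
Import Order.TTheory GRing.Theory Num.Theory.
Import numFieldNormedType.Exports.
Local Open Scope classical_set_scope.
Local Open Scope ring_scope.

Definition dotv (R : realType) (n : nat) (u v : 'cV[R]_n) : R :=
  (u^T *m v) 0 0.

(* An arbitrary norm on R^n, not the sup norm that the library attaches to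
   matrices. *)
Definition is_norm (R : realType) (n : nat) (nrm : 'cV[R]_n -> R) : Prop :=
  [/\ forall x y, nrm (x + y) <= nrm x + nrm y,
      forall (k : R) x, nrm (k *: x) = `|k| * nrm x
    & forall x, nrm x = 0 -> x = 0].

Definition dual_norm (R : realType) (n : nat) (nrm : 'cV[R]_n -> R)
    (y : 'cV[R]_n) : R :=
  sup [set dotv y z | z in [set z | nrm z <= 1]].

Definition polyhedron (R : realType) (n : nat) (X : set 'cV[R]_n) : Prop :=
  exists (m : nat) (G : 'M[R]_(m, n)) (h : 'cV[R]_m),
    X = [set x | forall i, (G *m x) i 0 <= h i 0].

(* R^n with its Borel sigma-algebra; convertible to 'cV[R]_n. The topology of
   'cV[R]_n is the one of any norm. *)
Notation borel_cV R n := (g_sigma_algebraType (@open 'cV[R]_n)).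

Section empirical.
Context (R : realType) (K N : nat).
Local Open Scope ereal_scope.

Definition empirical (xi : 'I_N -> 'cV[R]_K) (A : set (borel_cV R K)) : \bar R :=
  (N%:R^-1)%:E * \sum_(i < N) \d_(xi i : borel_cV R K) A.

Context (xi : 'I_N -> 'cV[R]_K).

Let empirical0 : empirical xi set0 = 0.
Proof. by rewrite /empirical big1 ?mule0// => i _; rewrite measure0. Qed.

Let empirical_ge0 A : 0 <= empirical xi A.
Proof.
apply: mule_ge0; first by rewrite lee_fin invr_ge0.
by apply: sume_ge0 => i _; exact: measure_ge0.
Qed.

Let empirical_sigma_additive : semi_sigma_additive (empirical xi).
Proof.
move=> F mF tF mUF.
pose m (k : nat) : {measure set (borel_cV R K) -> \bar R} :=
  if insub k is Some i then \d_(xi i : borel_cV R K) else mzero.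
have c0 : (0 <= N%:R^-1 :> R)%R by rewrite invr_ge0.
have E B : empirical xi B = mscale (NngNum c0) (msum m N) B.
  rewrite /empirical /mscale /= /msum; congr (_ * _).
  by apply: eq_bigr => i _; rewrite /m valK.
rewrite E (_ : (fun _ => _) = fun n =>
    \sum_(0 <= i < n) mscale (NngNum c0) (msum m N) (F i)).
  exact: measure_semi_sigma_additive.
by apply/funext => n; apply: eq_bigr => i _; rewrite E.
Qed.

HB.instance Definition _ := isMeasure.Build _ _ _ (empirical xi)
  empirical0 empirical_ge0 empirical_sigma_additive.

Lemma empirical_setT : (0 < N)%N -> empirical xi setT = 1.
Proof.
move=> N0; rewrite /empirical (eq_bigr (fun=> 1)); last first.
  by move=> i _; rewrite diracT.
by rewrite sumEFin sumr_const card_ord -EFinM mulVf// pnatr_eq0 -lt0n.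
Qed.

End empirical.

Definition coupling (R : realType) (K : nat)
    (P1 P2 : {measure set (borel_cV R K) -> \bar R}) :
    set (probability (borel_cV R K * borel_cV R K)%type R) :=
  [set g : probability (borel_cV R K * borel_cV R K)%type R |
     forall A : set (borel_cV R K), measurable A ->
       pushforward g fst A = P1 A /\ pushforward g snd A = P2 A].

(* Stated for measures rather than probabilities so that [empirical xi] need
   not be packaged as a probability, which it is only when 0 < N. *)
Definition wasserstein (R : realType) (K : nat) (nrm : 'cV[R]_K -> R)
    (P1 P2 : {measure set (borel_cV R K) -> \bar R}) : \bar R :=
  ereal_inf [set 'E_g[fun z => nrm ((z.1 : 'cV[R]_K) - (z.2 : 'cV[R]_K))%R]%E
            | g in coupling P1 P2].

Definition wasserstein_ball (R : realType) (K N : nat) (nrm : 'cV[R]_K -> R)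
    (xi : 'I_N -> 'cV[R]_K) (theta : R) : set (probability (borel_cV R K) R) :=
  [set P : probability (borel_cV R K) R |
     (wasserstein nrm P (empirical xi) <= theta%:E)%E].

Definition CVaR (R : realType) (K : nat) (eps : R)
    (P : probability (borel_cV R K) R) (l : 'cV[R]_K -> R) : \bar R :=
  ereal_inf [set (tau%:E + (eps^-1)%:E * 'E_P[fun z => Num.max (l z - tau)%R 0%R])%E
            | tau in [set: R]].

Definition cvar_loss (R : realType) (L K : nat) (A : 'M[R]_(L, K))
    (a : 'cV[R]_L) (b : 'cV[R]_K) (b0 : R) (x : 'cV[R]_L) (z : 'cV[R]_K) : R :=
  dotv a x - b0 + dotv (A^T *m x - b) z.

Definition C_CVaR (R : realType) (L K N : nat) (X : set 'cV[R]_L)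
    (A : 'M[R]_(L, K)) (a : 'cV[R]_L) (b : 'cV[R]_K) (b0 : R)
    (xi : 'I_N -> 'cV[R]_K) (eps theta : R) (nrm : 'cV[R]_K -> R) :
    set 'cV[R]_L :=
  [set x | X x /\
     (ereal_sup [set CVaR eps P (cvar_loss A a b b0 x)
                | P in wasserstein_ball nrm xi theta] <= 0)%E].

(* Optimal values are extended reals; [ereal_inf set0 = +oo] is the value of an
   infeasible program. *)
Definition Z_CVaR (R : realType) (L K N : nat) (X : set 'cV[R]_L)
    (c : 'cV[R]_L) (A : 'M[R]_(L, K)) (a : 'cV[R]_L) (b : 'cV[R]_K) (b0 : R)
    (xi : 'I_N -> 'cV[R]_K) (eps theta : R) (nrm : 'cV[R]_K -> R) : \bar R :=
  ereal_inf [set (dotv c x)%:E | x in C_CVaR X A a b b0 xi eps theta nrm].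

Definition C_ICC (R : realType) (L K N : nat) (X : set 'cV[R]_L)
    (A : 'M[R]_(L, K)) (a : 'cV[R]_L) (b : 'cV[R]_K) (b0 : R)
    (xi : 'I_N -> 'cV[R]_K) (eps theta : R) (nrm : 'cV[R]_K -> R)
    (kappa : 'cV[R]_N) : set ('cV[R]_L * 'cV[R]_N * R) :=
  [set z : 'cV[R]_L * 'cV[R]_N * R | let: (x, s, t) := z in
     [/\ X x,
         forall i, 0 <= s i 0,
         eps * N%:R * t - dotv (const_mx 1) s
           >= theta * N%:R * dual_norm nrm (b - A^T *m x)
       & forall i, kappa i 0 * (dotv (b - A^T *m x) (xi i) + b0 - dotv a x)
           >= t - s i 0]].

Definition Z_ICC (R : realType) (L K N : nat) (X : set 'cV[R]_L)
    (c : 'cV[R]_L) (A : 'M[R]_(L, K)) (a : 'cV[R]_L) (b : 'cV[R]_K) (b0 : R)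
    (xi : 'I_N -> 'cV[R]_K) (eps theta : R) (nrm : 'cV[R]_K -> R)
    (kappa : 'cV[R]_N) : \bar R :=
  ereal_inf [set (dotv c z.1.1)%:E
            | z in C_ICC X A a b b0 xi eps theta nrm kappa].

(* Main.v *)
Require Import Defs.
From HB Require Import structures.
From mathcomp Require Import all_boot all_order all_algebra.
From mathcomp Require Import all_classical all_reals all_analysis.
From mathcomp Require Import measurable_realfun lra.
Set Implicit Arguments.
Unset Strict Implicit.
Unset Printing Implicit Defensive.
Import Order.TTheory GRing.Theory Num.Theory.
Import numFieldNormedType.Exports.
Local Open Scope classical_set_scope.
Local Open Scope ring_scope.

(** Fix a decision and put [w = b - A^T x], so that the loss is affine in the
uncertain vector with slope [- w], and let [l_i] be its value at the i-th
sample.  Everything reduces to the closed form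
[[
  sup_P CVaR_eps(P, loss)
    = inf_tau (tau + (N^-1 \sum_i max(l_i - tau, 0) + theta * |w|_dual) / eps),
]]
where [P] runs over the Wasserstein ball: the right-hand side is nonpositive,
with the infimum attained, exactly when the linear constraints of the second
program are solvable, by [t = - tau] and [s_i = max(l_i - tau, 0)].

The sup is at most the right-hand side because [max(loss - tau, 0)] is Lipschitz
for the given norm with constant the dual norm of [w], so that transporting the
empirical distribution to [P] at cost [theta] raises its expectation by at most
[theta * |w|_dual] ([wasserstein_CVaR_le]).

It is at least the right-hand side because the worst case can be built by hand,
without any duality theorem.  Let [tau] be a [(1 - eps)]-quantile of the [l_i].
There are weights [0 <= q_i <= 1/N] of total mass [eps] that are saturated on
the samples with [l_i > tau] and vanish on those with [l_i < tau]
([exists_tail_weights]); the empirical CVaR is the [q]-average of the [l_i].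
Move this mass [q], and nothing else, by [- (theta / eps) v] with [v] in the
unit ball.  The cost is at most [theta], while the average loss over the moved
mass, hence the CVaR, grows by [theta / eps * (w . v)]
([wasserstein_CVaR_attained]).  Since neither [tau] nor [q] depends on [v], the
supremum over [v] gives the dual norm for a single [tau]
([worst_case_CVaR_le0]).

The transport cost is an integral on the product of two Borel sigma-algebras.
It enters only through monotonicity, which holds for every nonnegative
integrand because the integral is a supremum over simple functions; additivity
is reserved for functions built from affine ones by differences and maxima. *)

(** * Norms on column vectors and their dual norms *)

Lemma lipschitz_le_continuous (R : realType) (V : normedModType R) (f : V -> R)
    (C : R) :
  0 <= C -> (forall u v, f u - f v <= C * `|u - v|) -> continuous f.
Proof.
move=> C0 fC u; apply/cvgrPdist_le => e e0.
have C1 : 0 < C + 1 by rewrite ltr_wpDl.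
near=> v.
have uv : `|u - v| <= e / (C + 1).
  by near: v; apply: cvgr_dist_le; [exact: cvg_id|exact: divr_gt0].
apply: (@le_trans _ _ (C * `|u - v|)).
  by rewrite ler_norml fC andbT lerNl opprB distrC fC.
rewrite (@le_trans _ _ ((C + 1) * (e / (C + 1))))//; last first.
  by rewrite mulrC divfK// gt_eqF.
by apply: ler_pM => //; rewrite lerDl.
Unshelve. all: by end_near. Qed.

Section norms.
Context (R : realType) (n : nat).
Implicit Types u v w z : 'cV[R]_n.

Lemma dotvE u v : dotv u v = \sum_i u i 0 * v i 0.
Proof. by rewrite /dotv mxE; apply: eq_bigr => i _; rewrite mxE. Qed.

Lemma dotvDr w u v : dotv w (u + v) = dotv w u + dotv w v.
Proof. by rewrite /dotv mulmxDr mxE. Qed.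

Lemma dotvZr w k u : dotv w (k *: u) = k * dotv w u.
Proof. by rewrite /dotv -scalemxAr mxE. Qed.

Lemma dotvBr w u v : dotv w (u - v) = dotv w u - dotv w v.
Proof. by rewrite dotvDr -scaleN1r dotvZr mulN1r. Qed.

Lemma dotvNl w u : dotv (- w) u = - dotv w u.
Proof. by rewrite /dotv linearN/= mulNmx mxE. Qed.

Lemma entry_le_mx_norm z i : `|z i 0| <= `|z|.
Proof.
rewrite [leRHS]/Num.norm/= mx_normrE; apply/bigmax_geP; right.
by exists (i, 0).
Qed.

Lemma dotv_le_mx_norm w z : dotv w z <= (\sum_i `|w i 0|) * `|z|.
Proof.
rewrite dotvE mulr_suml; apply: ler_sum => i _.
by rewrite (le_trans (ler_norm _))// normrM ler_wpM2l// entry_le_mx_norm.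
Qed.

Lemma dotv_continuous w : continuous (dotv w).
Proof.
apply: (@lipschitz_le_continuous _ _ _ (\sum_i `|w i 0|)).
  by apply: sumr_ge0 => i _.
by move=> u v; rewrite -dotvBr; exact: dotv_le_mx_norm.
Qed.

Context (nrm : 'cV[R]_n -> R) (nrm_norm : is_norm nrm).

Lemma is_norm0 : nrm 0 = 0.
Proof. by case: nrm_norm => _ /(_ 0 0) + _; rewrite scale0r normr0 mul0r. Qed.

Lemma is_normN z : nrm (- z) = nrm z.
Proof.
by case: nrm_norm => _ /(_ (-1) z) + _; rewrite scaleN1r normrN1 mul1r.
Qed.

Lemma is_norm_ge0 z : 0 <= nrm z.
Proof.
case: nrm_norm => /(_ z (- z)) + _ _.
by rewrite subrr is_norm0 is_normN -mulr2n pmulrn_lge0.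
Qed.

Lemma is_norm_sum (I : Type) (s : seq I) (F : I -> 'cV[R]_n) :
  nrm (\sum_(i <- s) F i) <= \sum_(i <- s) nrm (F i).
Proof.
elim/big_rec2 : _ => [|i r z _ le_zr]; first by rewrite is_norm0.
case: nrm_norm => triangle _ _.
by apply: (le_trans (triangle _ _)); rewrite lerD2l.
Qed.

Lemma is_norm_le_mx_norm : exists2 C, 0 <= C & forall z, nrm z <= C * `|z|.
Proof.
exists (\sum_i nrm (delta_mx i 0)).
  by apply: sumr_ge0 => i _; exact: is_norm_ge0.
move=> z; rewrite [X in nrm X]matrix_sum_delta.
under eq_bigr do rewrite big_ord1.
rewrite (le_trans (is_norm_sum _ _))// mulr_suml; apply: ler_sum => i _.
case: nrm_norm => _ -> _.
by rewrite mulrC ler_wpM2l// ?is_norm_ge0// entry_le_mx_norm.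
Qed.

Lemma trmx_norm (v : 'rV[R]_n) : `|v^T| = `|v|.
Proof.
rewrite /Num.norm/= !mx_normrE; apply/eqP; rewrite eq_le; apply/andP; split;
 apply/bigmax_leP; split; rewrite ?bigmax_ge_id// => -[i j] _ /=;
 apply/bigmax_geP; right; exists (j, i); rewrite ?mxE//=.
Qed.

(** The other half of the equivalence of norms in finite dimension: a norm is
continuous, and attains a positive minimum on the compact unit sphere.  The
sphere is taken in row vectors, to which [bounded_closed_compact] applies. *)
Lemma mx_norm_le_is_norm : exists2 m, 0 < m & forall z, m * `|z| <= nrm z.
Proof.
pose S := [set v : 'rV[R]_n | `|v| = 1].
have [C C0 leC] := is_norm_le_mx_norm.
have cf : continuous (fun v : 'rV[R]_n => nrm v^T).
  apply: (@lipschitz_le_continuous _ _ _ C) => // u v.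
  rewrite -trmx_norm linearB/=; apply: le_trans (leC _).
  case: nrm_norm => /(_ (u^T - v^T) v^T) + _ _.
  by rewrite subrK -lerBlDr.
(* The sphere is empty when [n = 0]. *)
have [S0|/set0P/negP/negPn/eqP S0] := pselect (S !=set0); last first.
  exists 1 => // z; have [->|z0] := eqVneq z 0.
    by rewrite normr0 mulr0 is_norm0.
  suff : S (`|z|^-1 *: z)^T by rewrite S0.
  rewrite /S/= -trmx_norm trmxK normrZ ger0_norm ?invr_ge0// mulVf//.
  by rewrite normr_eq0.
have cS : compact S.
  apply: bounded_closed_compact.
    by exists 1; split => // x x1 v /= ->; exact: ltW.
  rewrite (_ : S = Num.norm @^-1` [set 1])//.
  by apply: closed_comp => [x _|]; [exact: norm_continuous|exact: closed_eq].
have [v] := EVT_min_rV S0 cS (continuous_subspaceT cf).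
rewrite inE => /= Sv minv.
exists (nrm v^T).
  rewrite lt_def is_norm_ge0 andbT; apply/eqP => v0.
  case: nrm_norm => _ _ /(_ _ v0) /eqP.
  by rewrite -normr_eq0 trmx_norm Sv oner_eq0.
move=> z; have [->|z0] := eqVneq z 0; first by rewrite normr0 mulr0 is_norm0.
have z1 : 0 < `|z| by rewrite normr_gt0.
have /minv : (`|z|^-1 *: z)^T \in S.
  rewrite inE /S/= -trmx_norm trmxK normrZ ger0_norm ?invr_ge0// mulVf//.
  by rewrite gt_eqF.
rewrite trmxK; case: nrm_norm => _ -> _.
by rewrite ger0_norm ?invr_ge0// ler_pdivlMl// mulrC.
Qed.

(** A real supremum is meaningful only for bounded sets: the unit ball of the
norm has to be bounded. *)
Lemma dual_norm_has_sup w : has_sup [set dotv w z | z in [set z | nrm z <= 1]].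
Proof.
split; first by exists (dotv w 0), 0 => //=; rewrite is_norm0.
have [m m0 lem] := mx_norm_le_is_norm.
exists ((\sum_i `|w i 0|) * m^-1) => _ [z /= z1 <-].
rewrite (le_trans (dotv_le_mx_norm _ _))// ler_wpM2l ?sumr_ge0//.
by rewrite -[leRHS]mulr1 ler_pdivlMl// (le_trans (lem z)).
Qed.

Lemma dual_norm_ge0 w : 0 <= dual_norm nrm w.
Proof.
apply: ub_le_sup; first exact: (dual_norm_has_sup w).2.
by exists 0; rewrite /= ?is_norm0// -(scale0r w) dotvZr mul0r.
Qed.

Lemma dotv_le_dual_norm w z : dotv w z <= dual_norm nrm w * nrm z.
Proof.
have [/eqP nz0|nz0] := boolP (nrm z == 0).
  case: nrm_norm => _ _ /(_ _ nz0) ->.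
  by rewrite is_norm0 mulr0 -(scale0r w) dotvZr mul0r.
have nz1 : 0 < nrm z by rewrite lt_def nz0 is_norm_ge0.
rewrite -ler_pdivrMr// mulrC -dotvZr.
apply: ub_le_sup; first exact: (dual_norm_has_sup w).2.
exists ((nrm z)^-1 *: z) => //=; case: nrm_norm => _ -> _.
by rewrite ger0_norm ?invr_ge0 ?is_norm_ge0// mulVf.
Qed.

End norms.

(** * Integrals of nonnegative functions and finitely supported measures *)

Section integrals.
Local Open Scope ereal_scope.
Context d (T : measurableType d) (R : realType).
Implicit Type mu : {measure set T -> \bar R}.
Import HBNNSimple.

(** The integral of a nonnegative function is the supremum of the integrals of
the simple functions below it, so monotonicity extends to integrands that are
not known to be measurable, such as the norm on the coupling space. *)
Lemma ge0_le_integral_pointwise mu (f g : T -> \bar R) :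
  (forall x, 0 <= f x) -> (forall x, f x <= g x) ->
  \int[mu]_x f x <= \int[mu]_x g x.
Proof.
move=> f0 fg; have g0 x : 0 <= g x by exact: le_trans (fg x).
rewrite !ge0_integralTE//; apply: ereal_sup_le => _ [h /= hf <-].
by exists h => // x; exact: le_trans (fg x).
Qed.

Lemma exists_mixture (I : finType) (p : I -> R) (x : I -> T) :
  (forall i, 0 <= p i)%R ->
  exists mu, (forall A, mu A = \sum_i (p i)%:E * \d_(x i) A) /\
    forall f : T -> \bar R, (forall z, 0 <= f z) -> measurable_fun setT f ->
      \int[mu]_z f z = \sum_i (p i)%:E * f (x i).
Proof.
move=> p0.
pose m (k : nat) : {measure set T -> \bar R} :=
  if insub k is Some i then
    mscale (NngNum (p0 (enum_val (i : 'I_#|I|)))) \d_(x (enum_val i))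
  else mzero.
exists (msum m #|I|); split.
  move=> A; rewrite (reindex _ (onW_bij _ (@enum_val_bij I)))/= /msum/=.
  by apply: eq_bigr => i _; rewrite /m valK.
move=> f f0 mf; rewrite ge0_integral_measure_sum//.
rewrite (reindex _ (onW_bij _ (@enum_val_bij I)))/=.
apply: eq_bigr => i _; rewrite /m valK ge0_integral_mscale//.
by rewrite integral_dirac// diracT mul1e.
Qed.

(** Stated for any measure that agrees with the mixture on measurable sets, so
that it also applies to the empirical distribution. *)
Lemma ge0_integral_mixture (I : finType) (p : I -> R) (x : I -> T) mu
    (f : T -> \bar R) :
  (forall i, 0 <= p i)%R ->
  (forall A, measurable A -> mu A = \sum_i (p i)%:E * \d_(x i) A) ->
  (forall z, 0 <= f z) -> measurable_fun setT f ->
  \int[mu]_z f z = \sum_i (p i)%:E * f (x i).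
Proof.
move=> p0 muE f0 mf; have [nu [nuE nuI]] := exists_mixture x p0.
rewrite -nuI//; apply: eq_measure_integral => A mA _.
by rewrite muE// nuE.
Qed.

(** A measure of mass one is its own normalization, and normalizations are
probabilities. *)
Lemma exists_mixture_probability (I : finType) (p : I -> R) (x : I -> T) :
  (forall i, 0 <= p i)%R -> (\sum_i p i = 1)%R ->
  exists P : probability T R, forall A, P A = \sum_i (p i)%:E * \d_(x i) A.
Proof.
move=> p0 p1; have [mu [muE _]] := exists_mixture x p0.
have mu1 : mu setT = 1.
  by rewrite muE; under eq_bigr do rewrite diracT mule1; rewrite sumEFin p1.
exists (mnormalize mu (\d_point : probability T R)) => A.
transitivity (mu A * (fine (mu setT))^-1%:E).
  by rewrite /= /mnormalize mu1 onee_eq0.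
by rewrite mu1 invr1 mule1 muE.
Qed.

(** For a nonmeasurable integrand only this inequality can be expected; it
bounds the cost of an explicit coupling. *)
Lemma integral_mixture_le (I : finType) (p : I -> R) (x : I -> T) mu
    (f : T -> R) :
  (forall i, 0 <= p i)%R ->
  (forall A, measurable A -> mu A = \sum_i (p i)%:E * \d_(x i) A) ->
  (forall z, 0 <= f z)%R ->
  \int[mu]_z (f z)%:E <= (\sum_i p i * f (x i))%:E.
Proof.
move=> p0 muE f0; rewrite ge0_integralTE => [|z]; last by rewrite lee_fin.
apply: ge_ereal_sup => _ [h /= hf <-].
rewrite -integralT_nnsfun (ge0_integral_mixture p0 muE)//.
- rewrite -sumEFin; apply: lee_sum => i _.
  by rewrite EFinM lee_wpmul2l// lee_fin.
- by move=> z; rewrite lee_fin.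
- exact/measurable_EFinP.
Qed.

(** This replaces pulling [k] out of the integral of [f], which need not be
measurable: dividing the measurable [g] by [k] is harmless. *)
Lemma ge0_integral_le_scale mu (k : R) (f g : T -> R) :
  (0 <= k)%R -> (forall z, 0 <= f z)%R -> measurable_fun setT g ->
  (forall z, 0 <= g z)%R -> (forall z, g z <= k * f z)%R ->
  \int[mu]_z (g z)%:E <= k%:E * \int[mu]_z (f z)%:E.
Proof.
move=> k0 f0 mg g0 gkf; have [kE|kN0] := eqVneq k 0%R.
  rewrite kE mul0e (_ : (fun z => (g z)%:E) = cst 0) ?integral0//.
  apply/funext => z; congr (_%:E); apply/eqP; rewrite eq_le g0 andbT.
  by have := gkf z; rewrite kE mul0r.
have {kN0}k1 : (0 < k)%R by rewrite lt_def kN0.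
rewrite (_ : (fun z => (g z)%:E) = fun z => k%:E * (k^-1 * g z)%:E); last first.
  by apply/funext => z; rewrite -EFinM mulrA divff ?mul1r// gt_eqF.
rewrite ge0_integralZl//; last 2 first.
- by apply/measurable_EFinP; exact: measurable_funM.
- by move=> z _; rewrite lee_fin mulr_ge0 ?invr_ge0.
rewrite lee_wpmul2l//; apply: ge0_le_integral_pointwise => z.
  by rewrite lee_fin mulr_ge0 ?invr_ge0.
by rewrite lee_fin ler_pdivrMl.
Qed.

End integrals.

(** * Worst tail of a finite sample *)

(** The weights [q] are the optimal dual solution in the representation of CVaR
as the largest mean over a fraction [eps] of the mass.  The threshold [tau] is
the least sample value that at most [eps * n] samples exceed; the samples tied
at [tau] share what is left of the mass [eps].  The third clause is
complementary slackness: all the available mass lies above [tau], none below. *)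
Lemma exists_tail_weights (R : realType) (n : nat) (l : 'I_n -> R) (eps : R) :
  (0 < n)%N -> 0 < eps -> eps < 1 ->
  exists tau : R, exists q : 'I_n -> R,
    [/\ forall i, 0 <= q i <= n%:R^-1, \sum_i q i = eps
      & forall i, q i * (l i - tau) = n%:R^-1 * Num.max (l i - tau) 0].
Proof.
move=> n0 eps0 eps1.
have n0R : 0 < n%:R :> R by rewrite ltr0n.
pose above t : R := \sum_i (t < l i)%R%:R.
pose P j := above (l j) <= eps * n%:R.
have [j1 _ maxj1] := @Order.TotalTheory.arg_maxP _ _ _ (Ordinal n0) xpredT l isT.
have Pj1 : P j1.
  rewrite /P /above big1 ?mulr_ge0 ?ltW// => i _.
  by rewrite ltNge [_ <= _](maxj1 i).
have [j Pj minj] := @Order.TotalTheory.arg_minP _ _ _ j1 P l Pj1.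
pose tau := l j; pose ties : R := \sum_i (l i == tau)%:R.
have ties0 : 0 < ties.
  by rewrite /ties (bigD1 j)//= eqxx ltr_pwDl// sumr_ge0.
have atleastE : above tau + ties = \sum_i (tau <= l i)%R%:R.
  rewrite -big_split; apply: eq_bigr => i _ /=.
  by case: ltgtP; rewrite ?addr0 ?add0r.
(* Otherwise the next smaller sample value would have been chosen. *)
have le_atleast : eps * n%:R <= above tau + ties.
  rewrite leNgt atleastE; apply/negP => lt_eps.
  have [k0 k0P|allge] := pickP (fun i => l i < tau); last first.
    move: lt_eps; under eq_bigr do rewrite leNgt allge.
    by rewrite sumr_const card_ord ltNge ler_piMl ?ltW.
  have [k kP maxk] :=
    @Order.TotalTheory.arg_maxP _ _ _ k0 (fun i => l i < tau) l k0P.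
  have Pk : P k.
    apply: le_trans (ltW lt_eps); apply: ler_sum => i _.
    rewrite ler_nat; case: (ltP (l k) (l i)) => // lt_ki.
    rewrite lt0b leNgt; apply/negP => /maxk /=.
    by rewrite leNgt lt_ki.
  by have := minj _ Pk; rewrite leNgt kP.
pose lam := (eps * n%:R - above tau) / ties.
have lam0 : 0 <= lam by rewrite divr_ge0// ?subr_ge0// ltW.
have lam1 : lam <= 1 by rewrite ler_pdivrMr// mul1r lerBlDl.
pose q i := n%:R^-1 * ((tau < l i)%R%:R + lam * (l i == tau)%:R).
exists tau, q; split.
- move=> i; rewrite /q.
  have /andP[ge0 le1] : 0 <= (tau < l i)%R%:R + lam * (l i == tau)%:R <= 1.
    by case: ltgtP; rewrite ?mulr0 ?mulr1 ?addr0 ?add0r ?lam0 ?lexx ?ler01.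
  by rewrite mulr_ge0 ?invr_ge0 ?(ltW n0R)// ler_piMr ?invr_ge0 ?(ltW n0R).
- rewrite -mulr_sumr big_split/= -mulr_sumr -/(above tau) -/ties.
  by rewrite divfK ?gt_eqF// addrC subrK mulrC mulfK// gt_eqF.
- move=> i; rewrite /q -mulrA; congr (_ * _).
  case: (ltgtP tau (l i)) => [h|h|->].
  + by rewrite mulr0 addr0 mul1r max_l// subr_ge0 ltW.
  + by rewrite mulr0 addr0 mul0r max_r// subr_le0 ltW.
  + by rewrite subrr mulr0 maxxx.
Qed.

(** * Transport from the empirical distribution *)

Section wasserstein.
Context (R : realType) (K : nat) (nrm : 'cV[R]_K -> R).
Context (nrm_norm : is_norm nrm).
Implicit Types P Q : {measure set (borel_cV R K) -> \bar R}.

Lemma continuous_measurable_borel (f : 'cV[R]_K -> R) :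
  continuous f -> measurable_fun [set: borel_cV R K] f.
Proof.
move=> /continuousP cf.
apply: (measurability _ (RGenOpens.measurableE R)) => //.
move=> _ [_ [a [b ->]] <-]; rewrite setTI.
by apply: sub_sigma_algebra; apply: cf; exact: interval_open.
Qed.

(** On the coupling space the increment [f z.1 - f z.2] is at most [C] times the
transport cost.  Only the positive part of the increment, which is measurable,
is separated from [f z.2] by additivity. *)
Lemma expectation_le_coupling P Q g (f : 'cV[R]_K -> R) (C : R) :
  0 <= C -> (forall z, 0 <= f z) -> measurable_fun [set: borel_cV R K] f ->
  (forall y z, f y <= f z + C * nrm (y - z)) -> coupling P Q g ->
  (\int[P]_z (f z)%:E <= \int[Q]_z (f z)%:E +
   C%:E * 'E_g[fun z => nrm ((z.1 : 'cV[R]_K) - (z.2 : 'cV[R]_K))%R])%E.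
Proof.
move=> C0 f0 mf lipf gPQ.
have mF1 : measurable_fun [set: borel_cV R K * borel_cV R K] (f \o fst).
  exact: measurableT_comp mf measurable_fst.
have mF2 : measurable_fun [set: borel_cV R K * borel_cV R K] (f \o snd).
  exact: measurableT_comp mf measurable_snd.
have -> : (\int[P]_z (f z)%:E = \int[g]_z ((f \o fst) z)%:E)%E.
  rewrite -(@ge0_integral_pushforward _ _ _ _ _ _ measurable_fst g setT
    (EFin \o f))//.
  - by apply: eq_measure_integral => A mA _; case: (gPQ A mA).
  - exact/measurable_EFinP.
  - by move=> z _; rewrite lee_fin.
have -> : (\int[Q]_z (f z)%:E = \int[g]_z ((f \o snd) z)%:E)%E.
  rewrite -(@ge0_integral_pushforward _ _ _ _ _ _ measurable_snd g setT
    (EFin \o f))//.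
  - by apply: eq_measure_integral => A mA _; case: (gPQ A mA).
  - exact/measurable_EFinP.
  - by move=> z _; rewrite lee_fin.
pose h z := Num.max ((f \o fst) z - (f \o snd) z) 0.
have mh : measurable_fun [set: borel_cV R K * borel_cV R K] h.
  by apply: measurable_maxr => //; exact: measurable_funB.
have h0 z : 0 <= h z by rewrite le_max lexx orbT.
apply: (@le_trans _ _ (\int[g]_z ((f (z.2))%:E + (h z)%:E))%E).
  apply: ge0_le_integral_pointwise => z; rewrite -?EFinD lee_fin//= ?f0//.
  by rewrite -lerBlDl le_max lexx.
rewrite ge0_integralD//; last 4 first.
- by move=> z _; rewrite lee_fin.
- exact/measurable_EFinP.
- by move=> z _; rewrite lee_fin.
- exact/measurable_EFinP.
rewrite leeD2l// unlock; apply: ge0_integral_le_scale => // z.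
  exact: is_norm_ge0.
by rewrite ge_max mulr_ge0 ?is_norm_ge0// andbT lerBlDl lipf.
Qed.

Lemma expectation_le_wasserstein P Q (f : 'cV[R]_K -> R) (C theta r : R) :
  0 <= C -> (forall z, 0 <= f z) -> measurable_fun [set: borel_cV R K] f ->
  (forall y z, f y <= f z + C * nrm (y - z)) ->
  (wasserstein nrm P Q <= theta%:E)%E -> (\int[Q]_z (f z)%:E)%E = r%:E ->
  (\int[P]_z (f z)%:E <= (r + C * theta)%:E)%E.
Proof.
move=> C0 f0 mf lipf PQ QE; apply/lee_addgt0Pr => e e0.
(* The infimum over couplings may not be attained, so take one of cost slightly
   above; dividing by [C + 1] rather than [C] allows [C = 0]. *)
have C1 : 0 < C + 1 by rewrite ltr_wpDl.
have [_ [g gPQ <-] cost] : exists2 y, [set 'E_g[fun z => nrm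
    ((z.1 : 'cV[R]_K) - (z.2 : 'cV[R]_K))%R]%E | g in coupling P Q] y &
    (y < (theta + e / (C + 1))%:E)%E.
  apply: ereal_inf_lt; apply: (le_lt_trans PQ).
  by rewrite lte_fin ltrDl divr_gt0.
apply: (le_trans (expectation_le_coupling C0 f0 mf lipf gPQ)).
apply: (@le_trans _ _ (r%:E + C%:E * (theta + e / (C + 1))%:E)%E).
  by rewrite QE leeD2l// lee_wpmul2l ?lee_fin// ltW.
rewrite -EFinM -!EFinD lee_fin mulrDr addrA lerD2l.
by rewrite mulrCA ler_piMr ?ltW// ltr_pdivrMr// mul1r ltrDl.
Qed.

Lemma empirical_integral N (xi : 'I_N -> 'cV[R]_K) (f : 'cV[R]_K -> R) :
  (forall z, 0 <= f z) -> measurable_fun [set: borel_cV R K] f ->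
  (\int[empirical xi]_z (f z)%:E)%E = (N%:R^-1 * \sum_i f (xi i))%:E.
Proof.
move=> f0 mf.
rewrite (@ge0_integral_mixture _ _ _ _ (fun=> N%:R^-1)
  (xi : _ -> borel_cV R K))//.
- by rewrite mulr_sumr -sumEFin; apply: eq_bigr => i _; rewrite EFinM.
- by move=> A mA; rewrite [LHS]ge0_sume_distrr.
- exact/measurable_EFinP.
Qed.

(** Each atom of mass [1 / N] is split into a part [q i], moved by [u], and a rest
that stays; the boolean index tells the moved part.  The plan that records the
origin of each part is a coupling of cost [(\sum_i q i) * nrm u].  Dropping the
part that stays only lowers the expectation of a nonnegative function. *)
Lemma exists_shifted_mixture N (xi : 'I_N -> 'cV[R]_K) (q : 'I_N -> R)
    (u : 'cV[R]_K) :
  (0 < N)%N -> (forall i, 0 <= q i <= N%:R^-1) ->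
  exists P : probability (borel_cV R K) R,
    (wasserstein nrm P (empirical xi) <= ((\sum_i q i) * nrm u)%:E)%E /\
    forall f : 'cV[R]_K -> R,
      (forall z, 0 <= f z) -> measurable_fun [set: borel_cV R K] f ->
      ((\sum_i q i * f (xi i + u)%R)%:E <= \int[P]_z (f z)%:E)%E.
Proof.
move=> N0 q01.
pose p (ib : 'I_N * bool) : R := if ib.2 then q ib.1 else N%:R^-1 - q ib.1.
pose y (ib : 'I_N * bool) : borel_cV R K :=
  if ib.2 then xi ib.1 + u else xi ib.1.
have p0 ib : 0 <= p ib.
  by rewrite /p; case: ib => i [] /=; rewrite ?subr_ge0; case/andP: (q01 i).
have sum_pairs (V : nmodType) (F : 'I_N * bool -> V) :
    \sum_ib F ib = \sum_i (F (i, true) + F (i, false)).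
  rewrite (eq_bigr (fun ib => F (ib.1, ib.2))); last by case.
  rewrite -(pair_bigA _ (fun i b => F (i, b)))/=; apply: eq_bigr => i _.
  by rewrite big_bool.
have p1 : \sum_ib p ib = 1.
  rewrite sum_pairs (eq_bigr (fun=> N%:R^-1)); last first.
    by move=> i _; rewrite addrC subrK.
  by rewrite sumr_const card_ord -[LHS]mulr_natr mulVf// pnatr_eq0 -lt0n.
have [g gE] := exists_mixture_probability
  (fun ib => (y ib, (xi ib.1 : borel_cV R K))) p0 p1.
have [P PE] := exists_mixture_probability y p0 p1.
exists P; split.
  apply: (@le_trans _ _ ('E_g[fun z => nrm
      ((z.1 : 'cV[R]_K) - (z.2 : 'cV[R]_K))%R])%E).
    apply: ereal_inf_lbound; exists g => // A mA; split.
      by rewrite /pushforward gE; exact/esym/PE.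
    rewrite /pushforward gE [RHS]ge0_sume_distrr//.
    rewrite sum_pairs; apply: eq_bigr => i _ /=.
    by rewrite !diracE -!EFinM -EFinD -mulrDl addrC subrK.
  rewrite unlock; apply: le_trans (integral_mixture_le p0 _ _) _.
  - by move=> A _; exact: gE.
  - by move=> z; exact: is_norm_ge0.
  rewrite lee_fin sum_pairs mulr_suml; apply: ler_sum => i _ /=.
  by rewrite /p /y/= addrAC subrr add0r is_norm0// mulr0 addr0.
move=> f f0 mf.
rewrite (ge0_integral_mixture p0 (fun A _ => PE A))//; last first.
  exact/measurable_EFinP.
rewrite sum_pairs -sumEFin; apply: lee_sum => i _ /=.
by rewrite -!EFinM -EFinD lee_fin lerDl mulr_ge0 ?f0// (p0 (i, false)).
Qed.

End wasserstein.

(** * Worst-case CVaR of an affine loss *)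

Definition affine_loss (R : realType) (K : nat) (d : R) (w z : 'cV[R]_K) : R :=
  d - dotv w z.

Section worst_case_CVaR.
Context (R : realType) (K N : nat) (nrm : 'cV[R]_K -> R).
Context (nrm_norm : is_norm nrm) (N_gt0 : (0 < N)%N).
Context (xi : 'I_N -> 'cV[R]_K) (eps theta : R).
Context (eps_gt0 : 0 < eps) (eps_lt1 : eps < 1) (theta_ge0 : 0 <= theta).
Context (w : 'cV[R]_K) (d : R).

Local Notation l := (affine_loss d w).

Let hinge_ge0 tau z : 0 <= Num.max (l z - tau) 0.
Proof. by rewrite le_max lexx orbT. Qed.

Let measurable_hinge tau :
  measurable_fun [set: borel_cV R K] (fun z => Num.max (l z - tau) 0).
Proof.
apply: measurable_maxr => //; apply: measurable_funB => //.
apply: measurable_funB => //.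
by apply: continuous_measurable_borel; exact: dotv_continuous.
Qed.

Lemma wasserstein_CVaR_le tau P :
  wasserstein_ball nrm xi theta P ->
  (CVaR eps P l <= (tau + eps^-1 *
     (N%:R^-1 * (\sum_i Num.max (l (xi i) - tau) 0)
      + dual_norm nrm w * theta))%:E)%E.
Proof.
move=> Pball; apply: (@le_trans _ _
    (tau%:E + eps^-1%:E * 'E_P[fun z => Num.max (l z - tau)%R 0%R])%E).
  by apply: ereal_inf_lbound; exists tau.
rewrite EFinD leeD2l// EFinM lee_wpmul2l ?lee_fin ?invr_ge0 ?(ltW eps_gt0)//.
rewrite unlock.
apply: (expectation_le_wasserstein nrm_norm (dual_norm_ge0 nrm_norm w)
  (hinge_ge0 tau) (measurable_hinge tau) _ Pball
  (empirical_integral xi (hinge_ge0 tau) (measurable_hinge tau))) => y z.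
have wyz : dotv w z - dotv w y <= dual_norm nrm w * nrm (y - z).
  rewrite -dotvBr -(is_normN nrm_norm) opprB.
  exact: dotv_le_dual_norm.
have := mulr_ge0 (dual_norm_ge0 nrm_norm w) (is_norm_ge0 nrm_norm (y - z)).
rewrite /affine_loss; case: (leP (d - dotv w y - tau) 0);
  case: (leP (d - dotv w z - tau) 0); lra.
Qed.

(** Up to the choice of [v], which is to approximate the dual norm of [w], the
shifted mixture is a worst case.  On the moved mass [q] the maximum is bounded
below by [loss - s], for every level [s] at once; there the mean loss is the
empirical one plus [theta / eps * dotv w v], and complementary slackness
rewrites the empirical one in terms of [tau]. *)
Lemma wasserstein_CVaR_attained : exists tau : R, forall v : 'cV[R]_K,
  nrm v <= 1 ->
  exists2 P, wasserstein_ball nrm xi theta P &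
    ((tau + eps^-1 * (N%:R^-1 * (\sum_i Num.max (l (xi i) - tau) 0)
      + theta * dotv w v))%:E <= CVaR eps P l)%E.
Proof.
have [tau [q [q01 q1 qtau]]] :=
  exists_tail_weights (fun i => l (xi i)) N_gt0 eps_gt0 eps_lt1.
exists tau => v v1; pose k := theta / eps; pose u := - k *: v.
have [P [Pball Pint]] := exists_shifted_mixture nrm_norm xi u N_gt0 q01.
exists P.
  apply: (le_trans Pball); rewrite lee_fin q1 /u.
  case: nrm_norm => _ -> _; rewrite normrN ger0_norm; last first.
    by rewrite divr_ge0// ltW.
  by rewrite mulrA mulrCA divff ?gt_eqF// mulr1 ler_piMr.
apply: le_ereal_inf_tmp => _ [s _ <-].
apply: (@le_trans _ _ (s%:E + eps^-1%:E *
    (\sum_i q i * Num.max (l (xi i + u)%R - s) 0)%:E)%E); last first.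
  rewrite leeD2l// lee_wpmul2l ?lee_fin ?invr_ge0 ?(ltW eps_gt0)//.
  rewrite expectation.unlock.
  exact: (Pint _ (hinge_ge0 s) (measurable_hinge s)).
rewrite -EFinM -EFinD lee_fin.
have qtauE : N%:R^-1 * (\sum_i Num.max (l (xi i) - tau) 0) =
    \sum_i q i * l (xi i) - eps * tau.
  rewrite mulr_sumr -q1 mulr_suml -sumrB; apply: eq_bigr => i _.
  by rewrite -qtau mulrBr.
have shifted : \sum_i q i * l (xi i) + theta * dotv w v - eps * s <=
    \sum_i q i * Num.max (l (xi i + u) - s) 0.
  have -> : theta * dotv w v = eps * (k * dotv w v).
    by rewrite mulrA /k [eps * _]mulrC divfK ?gt_eqF.
  rewrite -q1 !mulr_suml -big_split -sumrB; apply: ler_sum => i _ /=.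
  rewrite -mulrDr -mulrBr ler_wpM2l//; first by case/andP: (q01 i).
  rewrite le_max; apply/orP; left.
  rewrite /affine_loss dotvDr /u dotvZr; lra.
rewrite qtauE.
rewrite -(ler_pM2l eps_gt0) !mulrDr !mulrA divff ?gt_eqF// !mul1r.
lra.
Qed.

(** An actual [tau] is needed, not levels approaching an infimum, because [- tau]
becomes a variable of the linear program; [wasserstein_CVaR_attained] provides
one that serves all directions [v].  The factor [eps] matches the budget
constraint. *)
Lemma worst_case_CVaR_le0 :
  (ereal_sup [set CVaR eps P l | P in wasserstein_ball nrm xi theta] <= 0)%E <->
  exists tau : R,
    eps * tau + N%:R^-1 * (\sum_i Num.max (l (xi i) - tau) 0) +
      theta * dual_norm nrm w <= 0.
Proof.
split=> [sup_le0|[tau tauP]]; last first.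
  apply: ge_ereal_sup => _ [P Pball <-].
  apply: (le_trans (wasserstein_CVaR_le tau Pball)).
  rewrite lee_fin -(ler_pM2l eps_gt0) mulr0 mulrDr mulrA.
  by rewrite divff ?gt_eqF// mul1r addrA [_ * theta]mulrC.
have [tau tauP] := wasserstein_CVaR_attained; exists tau.
set H := \sum_i _ in tauP *.
have bound v : nrm v <= 1 ->
    theta * dotv w v <= - (eps * tau + N%:R^-1 * H).
  move=> /tauP[P Pball le_CVaR].
  have : (CVaR eps P l <= 0)%E.
    by apply: le_trans sup_le0; apply: ereal_sup_ubound; exists P.
  move=> /(le_trans le_CVaR); rewrite lee_fin -(ler_pM2l eps_gt0) mulr0 mulrDr.
  by rewrite mulrA divff ?gt_eqF// mul1r; lra.
rewrite addrC -lerBrDr sub0r.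
(* The supremum over [v] can be taken after dividing by [theta]; for
   [theta = 0] any single [v] will do. *)
have [theta0|theta_neq0] := eqVneq theta 0.
  have := bound 0; rewrite (is_norm0 nrm_norm) ler01 theta0 !mul0r.
  exact.
have theta_gt0 : 0 < theta by rewrite lt_def theta_neq0.
rewrite mulrC -ler_pdivlMr//.
apply: ge_sup; first exact: (dual_norm_has_sup nrm_norm w).1.
by move=> _ [v v1 <-]; rewrite ler_pdivlMr// mulrC bound.
Qed.

End worst_case_CVaR.

(** * Equality of the optimal values *)

Theorem proposition6 (R : realType) (L K N : nat) (N_gt0 : (0 < N)%N)
    (X : set 'cV[R]_L) (X_polyhedron : polyhedron X) (X_compact : compact X)
    (c : 'cV[R]_L) (A : 'M[R]_(L, K)) (a : 'cV[R]_L) (b : 'cV[R]_K) (b0 : R)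
    (A_neq_b : forall x, X x -> A^T *m x <> b)
    (xi : 'I_N -> 'cV[R]_K) (eps theta : R)
    (eps_gt0 : 0 < eps) (eps_lt1 : eps < 1) (theta_ge0 : 0 <= theta)
    (nrm : 'cV[R]_K -> R) (nrm_norm : is_norm nrm) :
  Z_CVaR X c A a b b0 xi eps theta nrm =
  Z_ICC X c A a b b0 xi eps theta nrm (const_mx 1).
Proof.
(* Both programs minimize the same cost over the same set of decisions [x]. *)
rewrite /Z_CVaR /Z_ICC; congr ereal_inf.
pose w x := b - A^T *m x; pose d x := dotv a x - b0.
have lossE x : cvar_loss A a b b0 x = affine_loss (d x) (w x).
  by apply/funext => z; rewrite /cvar_loss /affine_loss -dotvNl opprB.
have N0R : 0 < N%:R :> R by rewrite ltr0n.
have dot1 (s : 'cV[R]_N) : dotv (const_mx 1) s = \sum_i s i 0.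
  by rewrite dotvE; apply: eq_bigr => i _; rewrite mxE mul1r.
have CVaR_le0 x := worst_case_CVaR_le0 nrm_norm N_gt0 xi eps_gt0 eps_lt1
  theta_ge0 (w x) (d x).
apply/seteqP; split => [_ [x [Xx sup_le0] <-]|].
  have [tau tauP] : exists tau : R, eps * tau + N%:R^-1 *
      (\sum_i Num.max (affine_loss (d x) (w x) (xi i) - tau) 0) +
      theta * dual_norm nrm (w x) <= 0 by apply/CVaR_le0; rewrite -lossE.
  pose s := \col_i Num.max (affine_loss (d x) (w x) (xi i) - tau) 0.
  exists (x, s, - tau) => //=; split => // [i||i].
  - by rewrite mxE le_max lexx orbT.
  - rewrite dot1; under eq_bigr do rewrite mxE.
    move: tauP; rewrite -(ler_pM2l N0R) mulr0 !mulrDr mulVKf ?gt_eqF//.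
    by rewrite /w; lra.
  - rewrite !mxE mul1r.
    have : affine_loss (d x) (w x) (xi i) - tau <=
        Num.max (affine_loss (d x) (w x) (xi i) - tau) 0.
      by rewrite le_max lexx.
    by rewrite /affine_loss /d /w; lra.
move=> _ [[[x s] t] /= [Xx s0 budget cover] <-].
exists x => //; split => //; rewrite lossE; apply/CVaR_le0; exists (- t).
have hinge_le : \sum_i Num.max (affine_loss (d x) (w x) (xi i) - - t) 0 <=
    \sum_i s i 0.
  apply: ler_sum => i _; rewrite ge_max s0 andbT.
  by have := cover i; rewrite mxE mul1r /affine_loss /w /d; lra.
rewrite -(ler_pM2l N0R) mulr0 !mulrDr mulVKf ?gt_eqF//.
by move: budget hinge_le; rewrite dot1 -/(w x); lra.
Qed.
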